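(* Let $\mathcal{E}$ be a complex Hilbert space. A closed subspace $\mathcal{M}$ of $H^2_n\otimes\mathcal{E}$ is reducing for the multiplication tuple $M_z\otimes I_{\mathcal{E}}$ if and only if there exists a closed subspace $\mathcal{L}$ of $\mathcal{E}$ such that $\mathcal{M}=H^2_n\otimes\mathcal{L}$.
   Context: $\mathbb{B}_n$ is the open Euclidean unit ball of $\mathbb{C}^n$. $H^2_n(\mathcal{E})$ is the Hilbert space of analytic $f=\sum_{k\in\mathbb{N}^n}a_kz^k:\mathbb{B}_n\to\mathcal{E}$ with $\|f\|^2=\sum_k\|a_k\|^2/\gamma_k<\infty$, $\gamma_k=|k|!/k!$; $H^2_n=H^2_n(\mathbb{C})$, and $H^2_n(\mathcal{E})$ is identified with $H^2_n\otimes\mathcal{E}$. $M_z=(M_{z_1},\dots,M_{z_n})$ is the tuple of multiplications by the coordinate functions on $H^2_n$, and $M_z\otimes I_{\mathcal{E}}=(M_{z_1}\otimes I_{\mathcal{E}},\dots,M_{z_n}\otimes I_{\mathcal{E}})$. A closed subspace is reducing for a tuple if it is invariant under each component and each adjoint of a component. *)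

(* Defs.v *)
From HB Require Import structures.
From mathcomp Require Import all_boot all_order all_algebra finmap.
From mathcomp Require Import sesquilinear complex.
From mathcomp Require Import ring lra.
From mathcomp Require Import all_classical all_reals all_analysis.
From mathcomp.analysis.showcase Require summability.

Set Implicit Arguments.
Unset Strict Implicit.
Unset Printing Implicit Defensive.

Import Order.TTheory GRing.Theory Num.Theory.
Import numFieldNormedType.Exports.

Local Open Scope classical_set_scope.
Local Open Scope ring_scope.

#[export] Existing Instance summability.totally_filter.

(* Unconditional convergence of the family [x] to [l]: convergence of the
   finite partial sums along the filter of finite sets ordered by inclusion. *)
Definition has_sum (I : choiceType) (K : numDomainType) (V : normedModType K)
    (x : I -> V) (l : V) : Prop :=
  summability.partial_sum x @ summability.totally --> l.

Section HasSum.
Variables (I : choiceType) (K : numFieldType) (V : normedModType K).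
Implicit Types x y : I -> V.

Let psE (J : choiceType) (W : zmodType) (x : J -> W) (A : {fset J}) :
  summability.partial_sum x A = \sum_(i <- A) x i.
Proof. by rewrite /summability.partial_sum big_seq_fsetE. Qed.

Lemma has_sum_eq x y l : x =1 y -> has_sum x l -> has_sum y l.
Proof. by move=> /funext ->. Qed.

Lemma has_sumD x y l m :
  has_sum x l -> has_sum y m -> has_sum (fun i => x i + y i) (l + m).
Proof.
move=> xl ym; rewrite /has_sum.
rewrite (_ : summability.partial_sum _ =
  summability.partial_sum x \+ summability.partial_sum y).
  exact: cvgD.
by apply/funext => A /=; rewrite !psE big_split.
Qed.

Lemma has_sumZ (c : K) x l : has_sum x l -> has_sum (fun i => c *: x i) (c *: l).
Proof.
move=> xl; rewrite /has_sum.
rewrite (_ : summability.partial_sum _ = c \*: summability.partial_sum x).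
  exact: cvgZr.
by apply/funext => A /=; rewrite !psE scaler_sumr.
Qed.

Lemma has_sumZl (x : I -> K^o) (l : K^o) (v : V) :
  has_sum x l -> has_sum (fun i => x i *: v) (l *: v).
Proof.
move=> xl; rewrite /has_sum.
rewrite (_ : summability.partial_sum _ =
  fun A => summability.partial_sum x A *: v).
  exact: cvgZr_tmp.
by apply/funext => A /=; rewrite !psE scaler_suml.
Qed.

Lemma has_sum0 : has_sum (fun _ : I => 0 : V) 0.
Proof.
rewrite /has_sum (_ : summability.partial_sum _ = cst 0); first exact: cvg_cst.
by apply/funext => A; rewrite psE big1.
Qed.

Lemma has_sum_inj (J : choiceType) (s : I -> J) (p : J -> I) (y : J -> V) l :
    cancel s p -> (forall j, s (p j) != j -> y j = 0) ->
  has_sum (fun i => y (s i)) l -> has_sum y l.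
Proof.
move=> sK y0 ysl U /ysl [A _ AU]; exists (s @` A)%fset => // B AB.
change (U (summability.partial_sum y B)).
pose C := [fset p j | j in B & s (p j) == j]%fset.
suff <- : summability.partial_sum (fun i => y (s i)) C =
    summability.partial_sum y B.
  apply: AU => /=; apply/fsubsetP => i iA; apply/imfsetP; exists (s i) => /=.
    apply/andP; split => /=; last by rewrite sK.
    by apply/(fsubsetP AB); exact: in_imfset.
  by rewrite sK.
rewrite !psE [RHS](bigID (fun j => s (p j) == j))/= [X in _ + X]big1 ?addr0.
  rewrite big_imfset/=; last first.
    move=> j1 j2 /andP[_ /= /eqP e1] /andP[_ /= /eqP e2] e.
    by rewrite -e1 -e2 e.
  rewrite big_filter.
  by apply: eq_bigr => j /eqP ->.
by move=> j; exact: y0.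
Qed.

End HasSum.

Definition is_subspace (K : pzRingType) (V : lmodType K) (L : set V) : Prop :=
  L 0 /\ forall c u v, L u -> L v -> L (c *: u + v).

Section MultiIndex.
Variable n : nat.

Definition mindex := {ffun 'I_n -> nat}.

Definition mdeg (k : mindex) : nat := (\sum_i k i)%N.

Definition mfact (k : mindex) : nat := (\prod_i (k i)`!)%N.

Definition gamma (R : realType) (k : mindex) : R :=
  (mdeg k)`!%:R / (mfact k)%:R.

Definition mincr (i : 'I_n) (k : mindex) : mindex :=
  [ffun j => (k j + (j == i))%N].

Definition mdecr (i : 'I_n) (k : mindex) : mindex :=
  [ffun j => (k j - (j == i))%N].

Lemma mincrK i : cancel (mincr i) (mdecr i).
Proof. by move=> k; apply/ffunP => j; rewrite !ffunE addnK. Qed.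

Lemma gamma_gt0 (R : realType) k : 0 < gamma R k.
Proof.
rewrite /gamma divr_gt0// ltr0n ?fact_gt0//.
by apply: prodn_gt0 => i; rewrite fact_gt0.
Qed.

Lemma gamma_mincr (R : realType) i k : gamma R k <= gamma R (mincr i k).
Proof.
have dE : mdeg (mincr i k) = (mdeg k).+1.
  rewrite /mdeg (eq_bigr (fun j => k j + (j == i))%N); last first.
    by move=> j _; rewrite ffunE.
  rewrite big_split/= -[RHS]addn1; congr addn.
  by rewrite -big_mkcond/= big_pred1_eq.
have fE : mfact (mincr i k) = ((k i).+1 * mfact k)%N.
  rewrite /mfact (bigD1 i)//= [in RHS](bigD1 i)//= mulnA.
  rewrite ffunE eqxx addn1 factS; congr muln.
  by apply: eq_bigr => j /negbTE ji; rewrite ffunE ji addn0.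
have mf0 : (0 < mfact k)%N by apply: prodn_gt0 => j; rewrite fact_gt0.
rewrite /gamma dE fE factS !natrM invfM mulrACA -[leLHS]mul1r.
apply: ler_wpM2r; first by rewrite divr_ge0// ler0n.
rewrite ler_pdivlMr ?ltr0n// mul1r ler_nat ltnS /mdeg (bigD1 i)//=.
exact: leq_addr.
Qed.

End MultiIndex.

Section DruryArveson.
Variables (R : realType) (n : nat).
Local Notation C := R[i].

Definition unit_ball := {z : 'rV[C]_n | \sum_i `|z ord0 i| ^+ 2 < 1}.

Definition monomial (z : unit_ball) (k : mindex n) : C :=
  \prod_i val z ord0 i ^+ k i.

Lemma monomial_mincr z i k :
  monomial z (mincr i k) = val z ord0 i * monomial z k.
Proof.
rewrite /monomial (bigD1 i)//= [in RHS](bigD1 i)//= mulrA.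
rewrite ffunE eqxx addn1 exprS; congr (_ * _).
by apply: eq_bigr => j /negbTE ji; rewrite ffunE ji addn0.
Qed.

Let ReN0 (V : normedModType C) (v : V) : 0 <= complex.Re `|v|.
Proof. by have := normr_ge0 v; rewrite lecE => /andP[]. Qed.

Let ReZ (V : normedModType C) (c : C^o) (v : V) :
  complex.Re `|c *: v| = complex.Re `|c| * complex.Re `|v|.
Proof.
have im0 (W : normedModType C) (w : W) : complex.Im `|w| = 0.
  by have := normr_ge0 w; rewrite lecE => /andP[/eqP].
rewrite normrZ; move: (im0 _ c) (im0 _ v).
by case: `|c| => x y; case: `|v| => x' y' /= -> ->; rewrite mulr0 subr0.
Qed.

Let esumZ_le (r : R) (x : mindex n -> \bar R) :
    0 <= r -> (forall k, (0 <= x k)%E) ->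
  (\esum_(k in [set: mindex n]) (r%:E * x k) <=
   r%:E * \esum_(k in [set: mindex n]) x k)%E.
Proof.
move=> r0 x0; apply: ge_ereal_sup => _ [X FX <-].
rewrite -ge0_mule_fsumr//; apply: lee_wpmul2l; first by rewrite lee_fin.
by apply: esum_ge; exists X.
Qed.

Section Space.
Variable V : normedModType C.
Implicit Types (a b : mindex n -> V) (f g : unit_ball -> V).

(* Norms of [normedModType R[i]] are complex numbers, whence the real part. *)
Definition coef_sqnorm a : \bar R :=
  (\esum_(k in [set: mindex n]) (complex.Re `|a k| ^+ 2 / gamma R k)%:E)%E.

Definition h2_expansion f a : Prop :=
  (coef_sqnorm a < +oo)%E /\
  forall z, has_sum (fun k => monomial z k *: a k) (f z).

Definition h2_pred : {pred unit_ball -> V} :=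
  fun f => `[< exists a, h2_expansion f a >].

Let term_ge0 a k : (0 <= (complex.Re `|a k| ^+ 2 / gamma R k)%:E)%E.
Proof. by rewrite lee_fin divr_ge0 ?sqr_ge0// ltW// gamma_gt0. Qed.

Let ReD (v w : V) : complex.Re `|v + w| <= complex.Re `|v| + complex.Re `|w|.
Proof. by have := ler_normD v w; rewrite lecE => /andP[_]; rewrite raddfD. Qed.

Lemma coef_sqnormP (c : C) a b :
  (coef_sqnorm a < +oo -> coef_sqnorm b < +oo ->
   coef_sqnorm (fun k => (c *: a k + b k)%R) < +oo)%E.
Proof.
move=> aoo boo; set r := complex.Re `|c : C^o|.
have r0 : 0 <= r by exact: (ReN0 (V := C^o)).
pose B := ((2 * r ^+ 2)%:E * coef_sqnorm a + 2%:E * coef_sqnorm b)%E.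
apply: (@le_lt_trans _ _ B); last first.
  by rewrite lte_add_pinfty// lte_mul_pinfty// lee_fin ?mulr_ge0 ?sqr_ge0.
apply: le_trans (leeD (esumZ_le _ _) (esumZ_le _ _)); last 4 first.
- by rewrite mulr_ge0 ?sqr_ge0.
- exact: term_ge0.
- by [].
- exact: term_ge0.
rewrite -esumD; last 2 first.
- by move=> k _; rewrite mule_ge0 ?term_ge0// lee_fin mulr_ge0 ?sqr_ge0.
- by move=> k _; rewrite mule_ge0 ?term_ge0.
apply: le_esum => k _; rewrite -!EFinM -EFinD lee_fin !mulrA -mulrDl.
rewrite ler_wpM2r ?invr_ge0 ?(ltW (gamma_gt0 _ _))//.
have := ReD (c *: a k) (b k); rewrite ReZ -/r.
have := ReN0 (c *: a k + b k); have := ReN0 (a k); have := ReN0 (b k).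
move: (complex.Re _) (complex.Re `|a k|) (complex.Re `|b k|) => x u v.
move=> v0 u0 x0 xuv; have ru0 : 0 <= r * u by rewrite mulr_ge0.
have : x ^+ 2 <= (r * u + v) ^+ 2 by rewrite ler_pXn2r ?nnegrE ?addr_ge0.
have := sqr_ge0 (r * u - v); lra.
Qed.

Lemma coef_sqnorm0 : coef_sqnorm (fun=> 0) = 0%E.
Proof. by apply: esum1 => k _; rewrite normr0/= expr0n/= mul0r. Qed.

Let h2_submod_closed : submod_closed h2_pred.
Proof.
split=> [|c f g /asboolP[a [aoo fa]] /asboolP[b [boo gb]]].
  apply/asboolP; exists (fun=> 0); split; first by rewrite coef_sqnorm0 ltry.
  move=> z; apply: (has_sum_eq _ (@has_sum0 (mindex n) _ V)) => k.
  by rewrite scaler0.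
apply/asboolP; exists (fun k => c *: a k + b k); split.
  exact: coef_sqnormP.
move=> z; have := has_sumD (has_sumZ (c := c) (fa z)) (gb z).
apply: has_sum_eq => k.
by rewrite scalerDr !scalerA mulrC.
Qed.

HB.instance Definition _ := GRing.isSubmodClosed.Build C (unit_ball -> V)
  h2_pred h2_submod_closed.

Record H2 := MkH2 { h2fun :> unit_ball -> V; h2funP : h2fun \in h2_pred }.

HB.instance Definition _ := [isSub for h2fun].
HB.instance Definition _ := [Choice of H2 by <:].
HB.instance Definition _ := [SubChoice_isSubLmodule of H2 by <:].

Lemma h2_expansion_exists (F : H2) : exists a, h2_expansion F a.
Proof. exact/asboolP/(h2funP F). Qed.

(* The expansion of [F] is unique (identity theorem for power series), so the
   choice made by [cid] is immaterial. *)
Definition h2_coef (F : H2) : mindex n -> V := sval (cid (h2_expansion_exists F)).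

Definition h2_norm (F : H2) : R := Num.sqrt (fine (coef_sqnorm (h2_coef F))).

(* The inner product that polarizes [h2_norm], [dot] being that of the
   coefficient space. *)
Definition h2_dot (dot : V -> V -> C) (F G : H2) : C :=
  summability.sum (I := mindex n) (R := C^o)
    (fun k => dot (h2_coef F k) (h2_coef G k) / (gamma R k)%:C%C).

Let h2_mul_closed (i : 'I_n) (F : H2) :
  (fun z : unit_ball => val z ord0 i *: F z) \in h2_pred.
Proof.
have [a [aoo Fa]] := h2_expansion_exists F; apply/asboolP.
pose b j := if mincr i (mdecr i j) == j then a (mdecr i j) else 0.
have bE k : b (mincr i k) = a k by rewrite /b mincrK eqxx.
have b0 j : mincr i (mdecr i j) != j -> b j = 0 by rewrite /b => /negbTE ->.
exists b; split.
  apply: le_lt_trans aoo; rewrite /coef_sqnorm.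
  rewrite [leLHS](_ : _ = \esum_(j in range (mincr i))
      (complex.Re `|b j| ^+ 2 / gamma R j)%:E)%E; last first.
    rewrite [RHS]esum_mkcond; apply: eq_esum => j _; case: ifPn => // jr.
    rewrite b0 ?normr0/= ?expr0n/= ?mul0r//; apply: contraNN jr => /eqP <-.
    by apply/mem_set; exists (mdecr i j).
  rewrite esum_image; last by move=> x y _ _ /(can_inj (@mincrK n i)).
  apply: le_esum => k _; rewrite bE lee_fin ler_wpM2l ?sqr_ge0//.
  by rewrite lef_pV2 ?posrE ?gamma_gt0// gamma_mincr.
move=> z; apply: (has_sum_inj (@mincrK n i)) => [j /b0 ->|].
  by rewrite scaler0.
have := has_sumZ (c := val z ord0 i) (Fa z); apply: has_sum_eq => k.
by rewrite bE monomial_mincr scalerA.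
Qed.

Definition Mz (i : 'I_n) (F : H2) : H2 := MkH2 (h2_mul_closed i F).

End Space.

Let h2_tens_closed (V : normedModType C) (f : H2 C^o) (v : V) :
  (fun z : unit_ball => f z *: v) \in @h2_pred V.
Proof.
have [a [aoo fa]] := h2_expansion_exists f; apply/asboolP.
exists (fun k => a k *: v); split; last first.
  move=> z; have := has_sumZl (v := v) (fa z); apply: has_sum_eq => k.
  by rewrite scalerA.
set r := complex.Re `|v|; have r0 : 0 <= r ^+ 2 by rewrite sqr_ge0.
apply: (@le_lt_trans _ _ ((r ^+ 2)%:E * coef_sqnorm a)%E); last first.
  by rewrite lte_mul_pinfty.
apply: le_trans (esumZ_le r0 _); last first.
  by move=> k; rewrite lee_fin divr_ge0 ?sqr_ge0// ltW// gamma_gt0.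
apply: le_esum => k _; rewrite -EFinM lee_fin ReZ -/r exprMn.
by rewrite [leRHS]mulrCA mulrA.
Qed.

Definition h2_tens (V : normedModType C) (f : H2 C^o) (v : V) : H2 V :=
  MkH2 (h2_tens_closed f v).

Section Subspaces.
Variable V : normedModType C.

(* Topological closedness is with respect to the norm of H^2_n(V). *)
Definition h2_closed_subspace (M : set (H2 V)) : Prop :=
  is_subspace M /\
  forall F, (forall e : R, 0 < e -> exists2 G, M G & h2_norm (F - G) < e) ->
    M F.

Definition h2_adjoint (dot : V -> V -> C) (T S : H2 V -> H2 V) : Prop :=
  forall F G, h2_dot dot (T F) G = h2_dot dot F (S G).

(* The adjoint of [T i] is unique; [exists2] also asserts that it exists. *)
Definition h2_reducing (dot : V -> V -> C) (T : 'I_n -> H2 V -> H2 V)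
    (M : set (H2 V)) : Prop :=
  forall i, (forall F, M F -> M (T i F)) /\
    exists2 S, h2_adjoint dot (T i) S & forall F, M F -> M (S F).

(* H^2_n (x) L, as the closed linear span in H^2_n(V) of the elementary tensors
   [f (x) v] with [v] in [L]. *)
Definition h2_tensor (L : set V) : set (H2 V) :=
  \bigcap_(N in [set N | h2_closed_subspace N /\
                         forall f v, L v -> N (h2_tens f v)]) N.

End Subspaces.

End DruryArveson.

(* Main.v *)
(* An expansion is determined by its function: along the curve z_i = c t^(w_i)
   with weights w separating the multi-indices of bounded degree, the term of
   least weight dominates as t tends to 0.  By density of the polynomials,
   H^2 (x) L is then the set of F all of whose coefficients lie in L.  Testing
   against monomials shows that the adjoint of M_i is the weighted backward
   shift, with coefficients gamma_k / gamma_(k+e_i) a_(k+e_i), and it preserves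
   H^2 (x) L.  Conversely, if M is reducing, let L be the set of v whose constant
   function is in M.  The identity gamma_k = sum_i gamma_(k-e_i) gives
   F - sum_i M_i M_i^* F = F(0), so F(0) is in L for F in M, and applying this
   to iterated backward shifts of F puts every coefficient of F in L. *)
Require Import Defs.
From mathcomp Require Import all_boot all_order all_algebra finmap.
From mathcomp Require Import sesquilinear complex.
From mathcomp Require Import ring lra.
From mathcomp Require Import all_classical all_reals all_analysis.
From mathcomp.analysis.showcase Require summability.

Set Implicit Arguments.
Unset Strict Implicit.
Unset Printing Implicit Defensive.

Import Order.TTheory GRing.Theory Num.Theory.
Import numFieldNormedType.Exports.

Local Open Scope classical_set_scope.
Local Open Scope ring_scope.

(** * Real-valued norms and unconditional sums *)

Section RealNorm.
Variables (R : realType) (V : normedModType R[i]).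
Implicit Types v w : V.

(** Norms here take complex values that are nonnegative reals, so the real part loses nothing and
    makes suprema and square roots of reals available. *)
Definition rnorm v : R := complex.Re `|v|.

Lemma normE_rnorm v : `|v| = (rnorm v)%:C%C.
Proof.
rewrite /rnorm; have := normr_ge0 v.
by case: `|v| => x y; rewrite lecE /= => /andP[/eqP -> _].
Qed.

Lemma rnorm_ge0 v : 0 <= rnorm v.
Proof. by have := normr_ge0 v; rewrite lecE => /andP[]. Qed.

Lemma rnorm0 : rnorm 0 = 0.
Proof. by rewrite /rnorm normr0. Qed.

Lemma rnorm_eq0 v : rnorm v = 0 -> v = 0.
Proof. by move=> v0; apply/eqP; rewrite -normr_eq0 normE_rnorm v0. Qed.

Lemma rnormN v : rnorm (- v) = rnorm v.
Proof. by rewrite /rnorm normrN. Qed.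

Lemma rnormD v w : rnorm (v + w) <= rnorm v + rnorm w.
Proof.
by have := ler_normD v w; rewrite !normE_rnorm -rmorphD lecR.
Qed.

Lemma rnorm_sum (I : Type) (s : seq I) (P : pred I) (x : I -> V) :
  rnorm (\sum_(i <- s | P i) x i) <= \sum_(i <- s | P i) rnorm (x i).
Proof.
elim/big_ind2 : _ => [|x1 y1 x2 y2 h1 h2|//]; first by rewrite rnorm0.
by rewrite (le_trans (rnormD _ _))// lerD.
Qed.

End RealNorm.

Section ComplexModulus.
Variable R : realType.
Implicit Types c d : R[i].

Definition cabs c : R := complex.Re `|c|.

Lemma cabsE c : `|c| = (cabs c)%:C%C.
Proof. exact: (@normE_rnorm R R[i]^o). Qed.

Lemma cabs_ge0 c : 0 <= cabs c.
Proof. exact: (@rnorm_ge0 R R[i]^o). Qed.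

Lemma rnormZ (V : normedModType R[i]) c (v : V) : rnorm (c *: v) = cabs c * rnorm v.
Proof.
rewrite /rnorm /cabs normrZ; move: (cabsE c) (normE_rnorm v).
by case: `|c| => x y; case: `|v| => x' y' /= [_ ->] [_ ->]; rewrite mulr0 subr0.
Qed.

Lemma cabsM c d : cabs (c * d) = cabs c * cabs d.
Proof. exact: (rnormZ (V := R[i]^o)). Qed.

Lemma cabsR (x : R) : 0 <= x -> cabs x%:C%C = x.
Proof. by move=> x0; rewrite /cabs ger0_norm// lecR. Qed.

Lemma cabsX c m : cabs (c ^+ m) = cabs c ^+ m.
Proof.
elim: m => [|m IHm]; first by rewrite !expr0 (cabsR ler01).
by rewrite !exprS cabsM IHm.
Qed.

Lemma cabs_prod (I : Type) (s : seq I) (x : I -> R[i]) :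
  cabs (\prod_(i <- s) x i) = \prod_(i <- s) cabs (x i).
Proof. by apply: (big_morph _ cabsM); rewrite (cabsR ler01). Qed.

End ComplexModulus.

Section FiniteSums.
Variable I : choiceType.

Lemma fsum_split (W : nmodType) (A B : {fset I}) (x : I -> W) : (A `<=` B)%fset ->
  \sum_(i <- B) x i = \sum_(i <- A) x i + \sum_(i <- (B `\` A)%fset) x i.
Proof.
move=> AB; rewrite (big_fsetID _ (mem A)) /=; congr (_ + _); congr bigop.
  congr enum_fset; apply/fsetP => i; rewrite !inE/=.
  by apply/andP/idP => [[]//|iA]; split => //; exact: (fsubsetP AB).
by congr enum_fset; apply/fsetP => i; rewrite !inE/= andbC.
Qed.

Lemma fsum_single (W : nmodType) (A : {fset I}) (x : I -> W) k :
  (forall l, l != k -> x l = 0) -> \sum_(i <- A) x i = if k \in A then x k else 0.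
Proof.
move=> x0; case: ifPn => kA; last first.
  rewrite big_seq big1// => l lA; apply: x0.
  by apply: contraNneq kA => <-.
rewrite (big_fsetD1 k)//= big_seq big1 ?addr0// => l; rewrite !inE => /andP[lk _].
exact: x0.
Qed.

Variable R : realType.
Implicit Types u v : I -> R.

Definition bounded_sums u : Prop :=
  exists B, forall A : {fset I}, \sum_(i <- A) u i <= B.

Lemma le_bounded_sums u v :
  (forall i, u i <= v i) -> bounded_sums v -> bounded_sums u.
Proof.
move=> uv [B vB]; exists B => A; apply: le_trans (vB A).
by apply: ler_sum => i _; exact: uv.
Qed.

Lemma bounded_sumsD u v :
  bounded_sums u -> bounded_sums v -> bounded_sums (fun i => u i + v i).
Proof.
move=> [B uB] [D vD]; exists (B + D) => A.
by rewrite big_split/= lerD.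
Qed.

Lemma bounded_sumsZ (c : R) u :
  0 <= c -> bounded_sums u -> bounded_sums (fun i => c * u i).
Proof.
move=> c0 [B uB]; exists (c * B) => A.
by rewrite -mulr_sumr ler_wpM2l.
Qed.

(** Choose [A] with its sum within [e] of the supremum of all finite sums; a disjoint [B] adding [e]
    or more would push the sum over the union past that supremum. *)
Lemma bounded_sums_tail u (e : R) :
    0 < e -> (forall i, 0 <= u i) -> bounded_sums u ->
  exists A : {fset I}, forall B : {fset I}, [disjoint A & B]%fset ->
    \sum_(i <- B) u i < e.
Proof.
move=> e0 u0 [D uD].
have hs : has_sup (range (fun A : {fset I} => \sum_(i <- A) u i)).
  by split; [exists (\sum_(i <- fset0) u i), fset0 | exists D => _ [A _ <-]].
have [_ [A _ <-] Ae] := sup_adherent e0 hs; exists A => B AB.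
have : \sum_(i <- (A `|` B)%fset) u i <=
    sup (range (fun A : {fset I} => \sum_(i <- A) u i)).
  by apply: ub_le_sup; [case: hs | exists (A `|` B)%fset].
rewrite (fsum_split _ (fsubsetUl A B)) (_ : (A `|` B) `\` A = B)%fset; first lra.
apply/fsetP => i; rewrite !inE.
by case: (boolP (i \in A)) => //= iA; apply/esym/negbTE/(fdisjointP AB).
Qed.

Lemma esum_le_bound u (D : R) : (forall i, 0 <= u i) ->
    (forall A : {fset I}, \sum_(i <- A) u i <= D) ->
  (\esum_(i in [set: I]) (u i)%:E <= D%:E)%E.
Proof.
move=> u0 uD; apply: ge_ereal_sup => _ [X [fX _] <-].
by rewrite fsbig_finite//= sumEFin lee_fin.
Qed.

Lemma le_esum_fset u (A : {fset I}) :
  ((\sum_(i <- A) u i)%:E <= \esum_(i in [set: I]) (u i)%:E)%E.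
Proof.
apply: esum_ge; exists [set` A]; first by split => //; exact: finite_fset.
by rewrite fsbig_finite ?finite_fset//= set_fsetK sumEFin.
Qed.

Lemma esum_bounded u : (forall i, 0 <= u i) ->
  (\esum_(i in [set: I]) (u i)%:E < +oo)%E <-> bounded_sums u.
Proof.
move=> u0; split => [uoo|[D uD]]; last first.
  exact: le_lt_trans (esum_le_bound u0 uD) (ltry _).
have fu : \esum_(i in [set: I]) (u i)%:E \is a fin_num.
  by rewrite ge0_fin_numE//; apply: esum_ge0 => i _; rewrite lee_fin.
exists (fine (\esum_(i in [set: I]) (u i)%:E)) => A.
by rewrite -lee_fin fineK// le_esum_fset.
Qed.

End FiniteSums.

Section HasSumReal.
Variables (I : choiceType) (R : realType).

Lemma has_sumP (V : normedModType R[i]) (x : I -> V) l :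
  has_sum x l <-> forall e : R, 0 < e -> exists A : {fset I},
    forall B : {fset I}, (A `<=` B)%fset -> rnorm (l - \sum_(i <- B) x i) < e.
Proof.
rewrite /has_sum cvgrPdist_lt; split => [xl e e0|xl e].
  have /xl[A _ Ae] : 0 < e%:C%C by rewrite ltcR.
  exists A => B /Ae /=; rewrite /summability.partial_sum big_seq_fsetE.
  by rewrite normE_rnorm ltcR.
(* A complex number [e] with [0 < e] has zero imaginary part, so the real criterion applies to its
   real part. *)
rewrite ltcE => /andP[/eqP /= ei /xl[A Ae]]; exists A => // B /Ae.
rewrite /= /summability.partial_sum -(big_seq_fsetE _ B xpredT) normE_rnorm ltcE /=.
by rewrite ei eqxx.
Qed.

Lemma has_sum_fin (V : normedModType R[i]) (x : I -> V) (A : {fset I}) :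
  (forall i, i \notin A -> x i = 0) -> has_sum x (\sum_(i <- A) x i).
Proof.
move=> x0; apply/has_sumP => e e0; exists A => B AB.
suff -> : \sum_(i <- B) x i = \sum_(i <- A) x i by rewrite subrr rnorm0.
by apply/esym/big_fset_incl => // i _; exact: x0.
Qed.

Lemma has_sum_unique (V : normedModType R[i]) (x : I -> V) l m :
  has_sum x l -> has_sum x m -> l = m.
Proof. exact: cvg_unique. Qed.

(** Absolute summability makes the net of partial sums Cauchy, by smallness of the tails;
    completeness supplies the limit. *)
Lemma bounded_sums_has_sum (V : completeNormedModType R[i]) (x : I -> V) :
  bounded_sums (fun i => rnorm (x i)) -> exists l, has_sum x l.
Proof.
move=> bx; suff /cvg_ex[l xl] : cvg (summability.partial_sum x @ summability.totally).
  by exists l.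
apply: cauchy_cvg; apply: cauchy_exP => e.
rewrite ltcE => /andP[/eqP /= ei e0].
have [A Ae] := bounded_sums_tail e0 (fun i => rnorm_ge0 (x i)) bx.
exists (\sum_(i <- A) x i); exists A => // B AB.
rewrite /= /summability.partial_sum -(big_seq_fsetE _ B xpredT).
rewrite -ball_normE /= normE_rnorm (fsum_split _ AB) opprD addrA subrr add0r rnormN.
rewrite ltcE /= ei eqxx /= (le_lt_trans (rnorm_sum _ _ _))// Ae//.
by apply/fdisjointP => i iA; rewrite inE iA.
Qed.

End HasSumReal.

(** * Multi-indices *)

Section MultiIndexTheory.
Variable n : nat.
Implicit Types k l : mindex n.

Lemma mincr_mdecr i k : (0 < k i)%N -> mincr i (mdecr i k) = k.
Proof.
move=> ki; apply/ffunP => j; rewrite !ffunE.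
by case: eqVneq => [->|_]; rewrite ?subn0 ?addn0// subnK.
Qed.

Lemma mdeg_mincr i k : mdeg (mincr i k) = (mdeg k).+1.
Proof.
rewrite /mdeg (eq_bigr (fun j => k j + (j == i))%N); last first.
  by move=> j _; rewrite ffunE.
rewrite big_split/= -[RHS]addn1; congr addn.
by rewrite -big_mkcond/= big_pred1_eq.
Qed.

Lemma mfact_mincr i k : mfact (mincr i k) = ((k i).+1 * mfact k)%N.
Proof.
rewrite /mfact (bigD1 i)//= [in RHS](bigD1 i)//= mulnA.
rewrite ffunE eqxx addn1 factS; congr muln.
by apply: eq_bigr => j /negbTE ji; rewrite ffunE ji addn0.
Qed.

Definition mindex0 : mindex n := [ffun=> 0%N].

Lemma mdeg_eq0 k : (mdeg k == 0)%N = (k == mindex0).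
Proof.
apply/eqP/eqP => [|->]; last by rewrite /mdeg big1// => i _; rewrite ffunE.
move=> k0; apply/ffunP => i; rewrite ffunE; apply/eqP.
by rewrite -leqn0 -k0 /mdeg (bigD1 i)//= leq_addr.
Qed.

Lemma mindex_ind (P : mindex n -> Prop) :
  P mindex0 -> (forall i k, P k -> P (mincr i k)) -> forall k, P k.
Proof.
move=> P0 PS k; elim: {k}(mdeg k) {-2}k (erefl (mdeg k)) => [k /eqP|m IHm k km].
  by rewrite mdeg_eq0 => /eqP ->.
have [i ki] : exists i, (0 < k i)%N.
  have [i ki|k0] := pickP (fun i => 0 < k i)%N; first by exists i.
  by move: km; rewrite /mdeg big1// => i _; apply/eqP; rewrite -leqn0 leqNgt k0.
rewrite -(mincr_mdecr ki); apply/PS/IHm.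
by move: km; rewrite -{1}(mincr_mdecr ki) mdeg_mincr => -[].
Qed.

Variable R : realType.

Lemma gamma_ge0 k : 0 <= gamma R k.
Proof. exact/ltW/gamma_gt0. Qed.

Lemma gamma_neq0 k : gamma R k != 0.
Proof. exact/lt0r_neq0/gamma_gt0. Qed.

Lemma gamma_mindex0 : gamma R mindex0 = 1.
Proof.
have /eqP d0 : (mdeg mindex0 == 0)%N by rewrite mdeg_eq0.
rewrite /gamma d0 /mfact big1 ?divr1// => i _; by rewrite ffunE.
Qed.

Lemma gamma_ratio i k :
  gamma R k / gamma R (mincr i k) = (k i).+1%:R / (mdeg k).+1%:R.
Proof.
rewrite /gamma mdeg_mincr mfact_mincr factS !natrM.
have f0 m : (m`!)%:R != 0 :> R by rewrite pnatr_eq0 -lt0n fact_gt0.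
have mf0 : (mfact k)%:R != 0 :> R.
  by rewrite pnatr_eq0 -lt0n; apply: prodn_gt0 => j; rewrite fact_gt0.
have := f0 (mdeg k); set x := (_`!)%:R => x0; field.
by rewrite x0 mf0 !nat1r !pnatr_eq0.
Qed.

(** Pascal's rule for multinomial coefficients: the summand at [i] is [gamma R k] times
    [k i / mdeg k], and the entries of [k] add up to [mdeg k]. *)
Lemma sum_gamma_mdecr k : k != mindex0 ->
  \sum_(i | (0 < k i)%N) gamma R (mdecr i k) = gamma R k.
Proof.
rewrite -mdeg_eq0 => k0.
rewrite (eq_bigr (fun i => gamma R k * ((k i)%:R / (mdeg k)%:R))); last first.
  move=> i ki; have := gamma_ratio i (mdecr i k); rewrite (mincr_mdecr ki).
  have -> : (mdecr i k i).+1 = k i by rewrite ffunE eqxx subn1 prednK.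
  rewrite -(mdeg_mincr i) (mincr_mdecr ki) => <-.
  by rewrite mulrC divfK// gamma_neq0.
rewrite -mulr_sumr big_mkcond/= (eq_bigr (fun i => (k i)%:R / (mdeg k)%:R)).
  by rewrite -mulr_suml -natr_sum divff ?mulr1// pnatr_eq0.
by move=> i _; case: ifPn => //; rewrite -eqn0Ngt => /eqP ->; rewrite mul0r.
Qed.

(* A finite part of the multinomial expansion of [1 / (1 - sum x_i)], bounded
   through the recursion [gamma k = sum_i gamma (k - e_i)]. *)
Lemma sum_gamma_le (x : 'I_n -> R) (A : {fset mindex n}) :
    (forall i, 0 <= x i) -> \sum_i x i < 1 ->
  \sum_(k <- A) gamma R k * \prod_i x i ^+ k i <= (1 - \sum_i x i)^-1.
Proof.
move=> x0 x1; set s := \sum_i x i in x1 *; set D := (1 - s)^-1.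
pose P k := gamma R k * \prod_i x i ^+ k i.
have D0 : 0 <= D by rewrite invr_ge0 subr_ge0 ltW.
(* The bound [D] solves the same recursion as the terms [P k] below, so the induction closes with
   the same constant at every degree. *)
have DE : D = 1 + s * D by rewrite /D; field; rewrite subr_eq0 gt_eqF.
have PE k : P k = (k == mindex0)%:R + \sum_(i | (0 < k i)%N) x i * P (mdecr i k).
  have [->|k0] := eqVneq k mindex0.
    rewrite big1 ?addr0; last by move=> i; rewrite ffunE.
    by rewrite /P gamma_mindex0 big1 ?mulr1// => i _; rewrite ffunE expr0.
  rewrite add0r /P -sum_gamma_mdecr// mulr_suml; apply: eq_bigr => i ki.
  rewrite mulrCA; congr (_ * _); rewrite (bigD1 i)//= [in RHS](bigD1 i)//= mulrA.
  rewrite ffunE eqxx -exprS subn1 prednK//; congr (_ * _).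
  by apply: eq_bigr => j /negbTE ji; rewrite ffunE ji subn0.
(* Induction on a strict bound for the degrees: [mdecr i] is injective on the indices with positive
   entry at [i] and lowers the degree by one. *)
suff main m : forall B : {fset mindex n}, (forall k, k \in B -> (mdeg k < m)%N) ->
    \sum_(k <- B) P k <= D.
  apply: (main (\max_(k <- A) mdeg k).+1) => k kA.
  by rewrite ltnS (big_rem k)//= leq_maxl.
elim: m => [B Bm|m IHm B Bm].
  rewrite (_ : B = fset0) ?big_seq_fset0//; apply/fsetP => k; rewrite !inE.
  by apply/negP => /Bm.
rewrite (eq_bigr _ (fun k _ => PE k)) big_split/= DE; apply: lerD.
  have [B0|B0] := boolP (mindex0 \in B).
    rewrite (big_fsetD1 mindex0)//= eqxx big_seq big1 ?addr0// => k.
    by rewrite !inE => /andP[/negbTE ->].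
  rewrite big_seq big1// => k kB; case: eqVneq => // k0.
  by rewrite k0 (negbTE B0) in kB.
rewrite (exchange_big_dep xpredT)//= /s mulr_suml; apply: ler_sum => i _.
rewrite -mulr_sumr; apply: ler_wpM2l => //.
pose Bi := [fset k in B | (0 < k i)%N]%fset.
have -> : \sum_(k <- B | (0 < k i)%N) P (mdecr i k) =
    \sum_(j <- [fset mdecr i k | k in Bi]%fset) P j.
  rewrite big_imfset/=.
    by rewrite [LHS]big_fset_condE; apply: eq_fbigl => k; rewrite !inE.
  move=> k l; rewrite !inE/= => /andP[_ ki] /andP[_ li] kl.
  by rewrite -(mincr_mdecr ki) kl mincr_mdecr.
apply: IHm => j /imfsetP[k /=]; rewrite !inE/= => /andP[kB ki] {j}->.
by rewrite -ltnS -(mdeg_mincr i) mincr_mdecr// Bm.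
Qed.

End MultiIndexTheory.

(** * Integer weights that separate multi-indices of bounded degree *)

Section Weights.

(** Reduction modulo [b] reads off the lowest digit; cancelling it and dividing by [b] leaves one
    digit fewer. *)
Lemma digits_inj b n (k l : 'I_n -> nat) :
    (forall i, k i < b)%N -> (forall i, l i < b)%N ->
    (\sum_(i < n) k i * b ^ i = \sum_(i < n) l i * b ^ i)%N -> k =1 l.
Proof.
elim: n => [|n IHn] in k l * => kb lb; first by move=> _ [].
have rec (h : 'I_n.+1 -> nat) : (\sum_(i < n.+1) h i * b ^ i =
    (\sum_(i < n) h (lift ord0 i) * b ^ i) * b + h ord0)%N.
  rewrite big_ord_recl expn0 muln1 addnC big_distrl/=; congr addn.
  by apply: eq_bigr => i _; rewrite /bump add1n expnSr mulnA.
rewrite !rec => kl.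
have k0 : k ord0 = l ord0.
  by have := congr1 (modn^~ b) kl; rewrite !modnMDl !modn_small.
move: kl; rewrite k0 => /addIn /eqP.
rewrite eqn_pmul2r ?(leq_ltn_trans _ (kb ord0))// => /eqP kl.
move=> i; case: (unliftP ord0 i) => [j ->|->//].
by apply: (IHn (k \o lift ord0) (l \o lift ord0)) => // m; [exact: kb | exact: lb].
Qed.

Variable n : nat.
Implicit Types k l : mindex n.

Definition weight (w : 'I_n -> nat) k : nat := (\sum_i k i * w i)%N.

(* As [D] exceeds the base-[K+1] part [r] of the weight in degree at most [K], the
   weight compares the degree first. *)
Lemma separating_weights K : exists w : 'I_n -> nat,
  (forall k l, mdeg k <= K -> weight w l <= weight w k -> mdeg l <= K)%N /\
  (forall k l, (mdeg k <= K)%N -> (mdeg l <= K)%N ->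
     weight w k = weight w l -> k = l).
Proof.
pose D := (K * K.+1 ^ n).+1; pose r k := (\sum_i k i * K.+1 ^ i)%N.
exists (fun i => D + K.+1 ^ i)%N.
have wE k : weight (fun i => D + K.+1 ^ i)%N k = (mdeg k * D + r k)%N.
  by rewrite /weight /mdeg big_distrl/= -big_split/=; apply: eq_bigr => i _; rewrite mulnDr.
have rD k : (mdeg k <= K -> r k < D)%N.
  move=> kK; rewrite ltnS; apply: leq_trans (_ : mdeg k * K.+1 ^ n <= _)%N.
    rewrite /mdeg big_distrl/=; apply: leq_sum => i _.
    by rewrite leq_mul2l leq_pexp2l ?orbT// ltnW.
  by rewrite leq_mul2r kK orbT.
have dle k i : (k i <= mdeg k)%N by rewrite /mdeg (bigD1 i)//= leq_addr.
split=> [k l kK|k l kK lK]; rewrite !wE.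
  move=> lk; rewrite leqNgt; apply/negP => Kl.
  (* A degree above [K] forces weight at least [K.+1 * D], while the weight of [k] is below
     [K * D + D]. *)
  have := leq_trans (leq_addr (r l) _) lk; apply/negP; rewrite -ltnNge.
  apply: leq_trans (_ : K.+1 * D <= _)%N; last by rewrite leq_mul2r Kl orbT.
  by rewrite mulSn addnC -addSn leq_add ?rD// leq_mul2r kK orbT.
move=> kl; have rkl : r k = r l.
  by have := congr1 (modn^~ D) kl; rewrite !modnMDl !modn_small ?rD.
apply/ffunP; apply: (digits_inj (b := K.+1)) => // i;
  by rewrite ltnS (leq_trans (dle _ i)).
Qed.

End Weights.

(** * Coefficients of elements of H^2 *)

Section Expansions.
Variables (R : realType) (n : nat).
Implicit Types (z : unit_ball R n) (k l : mindex n).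

Lemma sum_cabs_ball z : \sum_i cabs (val z ord0 i) ^+ 2 < 1.
Proof.
have := valP z; rewrite -ltcR rmorph_sum rmorph1.
by congr (_ < _); apply: eq_bigr => i _; rewrite cabsE rmorphXn.
Qed.

Lemma real_point (x : 'I_n -> R) : (forall i, 0 <= x i) -> \sum_i x i ^+ 2 < 1 ->
  exists z, forall i, val z ord0 i = (x i)%:C%C.
Proof.
move=> x0 x1; have zP : \sum_i `|(\row_i (x i)%:C%C : 'rV[R[i]]_n) ord0 i| ^+ 2 < 1.
  move: x1; rewrite -ltcR rmorph_sum rmorph1.
  by congr (_ < _); apply: eq_bigr => i _; rewrite mxE cabsE cabsR// rmorphXn.
by exists (Sub (\row_i (x i)%:C%C) zP : unit_ball R n) => i; rewrite SubK mxE.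
Qed.

(** This family sums to the reproducing kernel of H^2 on the diagonal, 1 / (1 - |z|^2). *)
Lemma monomial_bounded z :
  bounded_sums (fun k => gamma R k * cabs (monomial z k) ^+ 2).
Proof.
exists (1 - \sum_i cabs (val z ord0 i) ^+ 2)^-1 => A.
apply: le_trans (sum_gamma_le A _ (sum_cabs_ball z)); last first.
  by move=> i; rewrite sqr_ge0.
apply: ler_sum => k _; rewrite /monomial cabs_prod -prodrXl le_eqVlt.
by apply/orP; left; apply/eqP; congr (_ * _); apply: eq_bigr => i _;
  rewrite cabsX exprAC.
Qed.

(** The point is z_i = t^(w_i) / (n+1). The factor 1 / (n+1) keeps the curve in the open ball up to
    and including t = 1, where the uniform bound in [expansion0_coef0] is taken. *)
Lemma weighted_point (w : 'I_n -> nat) (t : R) : 0 <= t -> t <= 1 ->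
  exists z, forall k,
    monomial z k = (n.+1%:R^-1 ^+ mdeg k * t ^+ weight w k)%:C%C.
Proof.
move=> t0 t1; pose x i : R := n.+1%:R^-1 * t ^+ w i.
have x0 i : 0 <= x i by rewrite mulr_ge0 ?exprn_ge0// invr_ge0.
have xn i : x i <= n.+1%:R^-1.
  by rewrite -[leRHS]mulr1 ler_wpM2l ?invr_ge0// exprn_ile1.
have [|z zE] := real_point x0.
  apply: (@le_lt_trans _ _ (\sum_(i < n) n.+1%:R^-1)).
    apply: ler_sum => i _; apply: le_trans (xn i).
    rewrite expr2 -[leRHS]mulr1 ler_wpM2l// (le_trans (xn i))//.
    by rewrite invf_le1 ?ltr0n// ler1n.
  by rewrite sumr_const card_ord -[_ *+ n]mulr_natl ltr_pdivrMr ?ltr0n// mul1r ltr_nat.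
exists z => k; rewrite /monomial /mdeg /weight.
rewrite (eq_bigr (fun i => (x i ^+ k i)%:C%C)); last by move=> i _; rewrite zE rmorphXn.
rewrite -rmorph_prod; congr (_%:C%C); rewrite -!prodrXr -big_split/=.
by apply: eq_bigr => i _; rewrite /x exprMn -exprM mulnC.
Qed.

Section Coefficients.
Variable V : normedModType R[i].
Implicit Types (a b : mindex n -> V) (f : unit_ball R n -> V).

Lemma coef_term_ge0 a k : 0 <= rnorm (a k) ^+ 2 / gamma R k.
Proof. by rewrite divr_ge0 ?sqr_ge0// gamma_ge0. Qed.

Lemma coef_sqnorm_bounded a : (coef_sqnorm a < +oo)%E <->
  bounded_sums (fun k => rnorm (a k) ^+ 2 / gamma R k).
Proof. exact: (esum_bounded (coef_term_ge0 a)). Qed.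

Lemma expansion_bounded a z : (coef_sqnorm a < +oo)%E ->
  bounded_sums (fun k => rnorm (monomial z k *: a k)).
Proof.
move=> /coef_sqnorm_bounded ba.
apply: le_bounded_sums (bounded_sumsD (monomial_bounded z) ba) => k.
rewrite rnormZ; set p := cabs _; set q := rnorm _.
have p0 : 0 <= p := cabs_ge0 _; have q0 : 0 <= q := rnorm_ge0 _.
have := gamma_gt0 R k; set g := gamma R k => g0.
(* Termwise comparison with the kernel terms plus the terms of the square norm, by completing the
   square in p q <= g p^2 + q^2 / g. *)
rewrite -subr_ge0.
have -> : g * p ^+ 2 + q ^+ 2 / g - p * q = g * (p - q / g) ^+ 2 + p * q.
  by field; rewrite gt_eqF.
by apply: addr_ge0; apply: mulr_ge0 => //; [exact: ltW | exact: sqr_ge0].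
Qed.

Lemma expansion0_coef0 a : (coef_sqnorm a < +oo)%E ->
  (forall z, has_sum (fun k => monomial z k *: a k) 0) -> forall k, a k = 0.
Proof.
move=> aoo a0 k0; have [w [wK w_inj]] := separating_weights n (mdeg k0).
(* Induction on the weight, among indices of degree at most that of [k0]. *)
suff main m : forall k, (mdeg k <= mdeg k0)%N -> (weight w k < m)%N -> a k = 0.
  exact: (main (weight w k0).+1).
elim: m => [//|m IHm] k kK; rewrite ltnS => km.
(* Such an [l] also has bounded degree, so separation makes its weight strictly smaller and the
   induction hypothesis applies. *)
have a0k l : l != k -> (weight w l <= weight w k)%N -> a l = 0.
  move=> lk wlk; have lK := wK _ _ kK wlk.
  apply: IHm => //; apply: leq_trans km; rewrite ltn_neqAle wlk andbT.
  by apply: contraNneq lk => /(w_inj _ _ lK kK) ->.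
pose c : R := n.+1%:R^-1; have c0 : 0 < c by rewrite invr_gt0.
pose u l := c ^+ mdeg l * rnorm (a l).
have u0 l : 0 <= u l by rewrite mulr_ge0 ?rnorm_ge0// exprn_ge0// ltW.
(* Absolute convergence at the point t = 1 bounds the terms for all smaller t at once. *)
have [S uS] : bounded_sums u.
  have [z1 z1E] := weighted_point w ler01 (lexx 1).
  apply: le_bounded_sums (expansion_bounded z1 aoo) => l.
  by rewrite rnormZ z1E expr1n mulr1 cabsR// exprn_ge0// ltW.
have ukS : u k <= S by have := uS [fset k]%fset; rewrite big_seq_fset1.
have small t : 0 < t -> t < 1 -> u k <= t * S.
  move=> t0 t1; have [z zE] := weighted_point w (ltW t0) (ltW t1).
  have termE l : rnorm (monomial z l *: a l) = t ^+ weight w l * u l.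
    rewrite rnormZ zE cabsR; first by rewrite /u mulrCA mulrA.
    by rewrite mulr_ge0 ?exprn_ge0// ltW.
  have tk : 0 < t ^+ weight w k by rewrite exprn_gt0.
  rewrite -(ler_pM2l tk) [leRHS]mulrA -exprSr; apply/ler_addgt0Pr => e e0.
  have [A Ae] := (has_sumP _ _).1 (a0 z) _ e0.
  have := Ae _ (fsubsetUl A [fset k]%fset); set B := (A `|` _)%fset.
  have kB : k \in B by rewrite !inE eqxx orbT.
  rewrite sub0r rnormN (big_fsetD1 k)//=; set x := monomial z k *: a k.
  set y := (X in x + X) => xye.
  have : rnorm y <= t ^+ (weight w k).+1 * S.
    apply: le_trans (rnorm_sum _ _ _) _.
    apply: (@le_trans _ _ (\sum_(l <- (B `\ k)%fset) t ^+ (weight w k).+1 * u l)).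
      rewrite big_seq [leRHS]big_seq; apply: ler_sum => l.
      rewrite !inE termE => /andP[lk _].
      have [lw|lw] := leqP (weight w l) (weight w k).
        by rewrite /u (a0k l)// rnorm0 !mulr0.
      by rewrite ler_wpM2r// ler_wiXn2l// ltW.
    by rewrite -mulr_sumr ler_wpM2l// exprn_ge0// ltW.
  have : rnorm x <= rnorm (x + y) + rnorm y.
    by rewrite -{1}(addrK y x) -(rnormN y) rnormD.
  rewrite -/x termE; lra.
have : u k <= 0.
  rewrite leNgt; apply/negP => uk0; have S0 := lt_le_trans uk0 ukS.
  have S2 : 0 < 2 * S by rewrite mulr_gt0.
  move: uk0 ukS small; move: (u k) => x x_gt0 xS small.
  (* With t = x / (2 S) the estimate reads x <= x / 2, which contradicts x > 0. *)
  have t1 : x / (2 * S) < 1 by rewrite ltr_pdivrMr// mul1r; lra.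
  have := small _ (divr_gt0 x_gt0 S2) t1.
  have -> : x / (2 * S) * S = x / 2 by field; rewrite gt_eqF.
  lra.
move=> uk; apply/rnorm_eq0/eqP; have /eqP : u k = 0 by apply/eqP; rewrite eq_le uk u0.
by rewrite mulf_eq0 expf_eq0 gt_eqF// andbF.
Qed.

Lemma h2_expansion_unique f a b : h2_expansion f a -> h2_expansion f b -> a = b.
Proof.
move=> [aoo fa] [boo fb]; apply/funext => k; apply/esym/eqP; rewrite -subr_eq0.
rewrite -scaleN1r addrC; apply/eqP.
apply: (expansion0_coef0 (a := fun k => -1 *: a k + b k)).
  exact: coef_sqnormP.
move=> z; have := has_sumD (has_sumZ (c := -1) (fa z)) (fb z).
rewrite scaleN1r addNr; apply: has_sum_eq => l.
by rewrite scalerDr !scalerA mulrC.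
Qed.

Lemma h2_coefP (F : H2 n V) : h2_expansion F (h2_coef F).
Proof. exact: svalP. Qed.

Lemma h2_coefE (F : H2 n V) a : h2_expansion F a -> h2_coef F = a.
Proof. exact/h2_expansion_unique/h2_coefP. Qed.

Lemma h2_coef_inj : injective (@h2_coef R n V).
Proof.
move=> F G FG; apply/val_inj/funext => z /=.
apply: has_sum_unique ((h2_coefP F).2 z) _; rewrite FG; exact: (h2_coefP G).2.
Qed.

Lemma h2_coefD (F G : H2 n V) k : h2_coef (F + G) k = h2_coef F k + h2_coef G k.
Proof.
have [Foo FE] := h2_coefP F; have [Goo GE] := h2_coefP G.
rewrite (@h2_coefE _ (fun k => 1 *: h2_coef F k + h2_coef G k)) ?scale1r//.
split; first exact: coef_sqnormP.
move=> z; have := has_sumD (FE z) (GE z); apply: has_sum_eq => l.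
by rewrite scale1r scalerDr.
Qed.

Lemma h2_coef0 k : h2_coef (0 : H2 n V) k = 0.
Proof. by apply: (addrI (h2_coef 0 k)); rewrite -h2_coefD !addr0. Qed.

Lemma h2_coefZ (c : R[i]) (F : H2 n V) k : h2_coef (c *: F) k = c *: h2_coef F k.
Proof.
have [Foo FE] := h2_coefP F; have [Zoo ZE] := h2_coefP 0.
rewrite (@h2_coefE _ (fun k => c *: h2_coef F k + h2_coef 0 k)) ?h2_coef0 ?addr0//.
split; first exact: coef_sqnormP.
move=> z; have := has_sumZ (c := c) (FE z); apply: has_sum_eq => l.
by rewrite h2_coef0 addr0 !scalerA mulrC.
Qed.

Lemma h2_coefB (F G : H2 n V) k : h2_coef (F - G) k = h2_coef F k - h2_coef G k.
Proof. by rewrite h2_coefD -scaleN1r h2_coefZ scaleN1r. Qed.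

Lemma h2_coef_sum (I : Type) (s : seq I) (P : pred I) (F : I -> H2 n V) k :
  h2_coef (\sum_(i <- s | P i) F i) k = \sum_(i <- s | P i) h2_coef (F i) k.
Proof.
elim/big_rec2 : _ => [|i G x _ <-]; first exact: h2_coef0.
exact: h2_coefD.
Qed.

Lemma h2_coef_Mz i (F : H2 n V) k : h2_coef (Mz i F) k =
  if (0 < k i)%N then h2_coef F (mdecr i k) else 0.
Proof.
have [Foo FE] := h2_coefP F.
pose b k := if (0 < k i)%N then h2_coef F (mdecr i k) else 0.
have bE l : b (mincr i l) = h2_coef F l by rewrite /b ffunE eqxx addn1 mincrK.
have bN l : mincr i (mdecr i l) != l -> b l = 0.
  by rewrite /b; case: ifPn => // /mincr_mdecr ->; rewrite eqxx.
rewrite (@h2_coefE _ b)//; split; last first.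
  move=> z; apply: (has_sum_inj (@mincrK n i)) => [l /bN ->|]; first by rewrite scaler0.
  have := has_sumZ (c := val z ord0 i) (FE z); apply: has_sum_eq => l.
  by rewrite bE monomial_mincr scalerA.
have /coef_sqnorm_bounded[S FS] := Foo; apply/coef_sqnorm_bounded; exists S => A.
(* Only indices with positive entry at [i] contribute; on them [mdecr i] is injective, and [gamma]
   does not increase under it. *)
pose Ai := [fset l in A | (0 < l i)%N]%fset.
apply: le_trans (FS [fset mdecr i l | l in Ai]%fset).
rewrite big_imfset/=; last first.
  move=> k1 k2; rewrite !inE/= => /andP[_ ki] /andP[_ li] kl.
  by rewrite -(mincr_mdecr ki) kl mincr_mdecr.
rewrite (bigID (fun l : mindex n => (0 < l i)%N))/= [X in _ + X]big1 ?addr0; last first.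
  by move=> l /negbTE l0; rewrite /b l0 rnorm0 expr0n/= mul0r.
rewrite [leLHS]big_fset_condE/= [leRHS]big_seq [leLHS]big_seq.
apply: ler_sum => l; rewrite !inE/= => /andP[_ li]; rewrite /b li.
apply: ler_wpM2l; first exact: sqr_ge0.
by rewrite lef_pV2 ?posrE ?gamma_gt0// -{2}(mincr_mdecr li) gamma_mincr.
Qed.

Lemma mono_expansion k (v : V) :
  h2_expansion (fun z => monomial z k *: v) (fun l => if l == k then v else 0).
Proof.
split.
  apply/coef_sqnorm_bounded; exists (rnorm v ^+ 2 / gamma R k) => A.
  rewrite (@fsum_single _ _ _ _ k); last first.
    by move=> l /negbTE ->; rewrite rnorm0 expr0n/= mul0r.
  by rewrite eqxx; case: ifP => // _; exact: (coef_term_ge0 (fun=> v)).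
move=> z; rewrite -[X in has_sum _ X](_ : \sum_(l <- [fset k]%fset)
    monomial z l *: (if l == k then v else 0) = _).
  by apply: has_sum_fin => l; rewrite inE => /negbTE ->; rewrite scaler0.
by rewrite big_seq_fset1 eqxx.
Qed.

Lemma h2_mono_proof k (v : V) :
  (fun z : unit_ball R n => monomial z k *: v) \in @h2_pred R n V.
Proof. by apply/asboolP; eexists; exact: mono_expansion. Qed.

Definition h2_mono k (v : V) : H2 n V := MkH2 (h2_mono_proof k v).

Lemma h2_coef_mono k v l : h2_coef (h2_mono k v) l = if l == k then v else 0.
Proof. by rewrite (@h2_coefE (h2_mono k v) _ (mono_expansion k v)). Qed.

Lemma Mz_mono i k v : Mz i (h2_mono k v) = h2_mono (mincr i k) v.
Proof.
by apply/val_inj/funext => z /=; rewrite monomial_mincr scalerA.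
Qed.

End Coefficients.
End Expansions.

(** * Tensor subspaces and adjoints of the shifts *)

(* Both limits are taken along the same image filter, so that no convergence is
   needed. *)
Lemma sum_inj (I J : choiceType) (K : numFieldType) (V : normedModType K)
    (s : I -> J) (p : J -> I) (y : J -> V) :
    cancel s p -> (forall j, s (p j) != j -> y j = 0) ->
  summability.sum y = summability.sum (fun i => y (s i)).
Proof.
move=> sK y0; have psE (T : choiceType) (x : T -> V) (A : {fset T}) :
    summability.partial_sum x A = \sum_(i <- A) x i.
  by rewrite /summability.partial_sum big_seq_fsetE.
have imE (B : {fset I}) : \sum_(i <- B) y (s i) = \sum_(j <- (s @` B)%fset) y j.
  by rewrite big_imfset//= => i j _ _; exact: can_inj sK _ _.
rewrite /summability.sum; congr (lim _); apply/seteqP; split => U [A _ AU].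
  exists (p @` A)%fset => // B AB; change (U (summability.partial_sum (y \o s) B)).
  (* Adding [A] to the image of [B] changes nothing: an index of [A] in the range of [s] is already
     in that image, and [y] vanishes off the range. *)
  rewrite psE imE (big_fset_incl _ (fsubsetUl _ A)).
    by rewrite -psE; apply: AU; exact: fsubsetUr.
  move=> j; rewrite !inE => /orP[->//|jA] jB; apply: y0; apply: contraNneq jB => <-.
  by apply/in_imfset/(fsubsetP AB)/in_imfset.
exists (s @` A)%fset => // B AB; change (U (summability.partial_sum y B)).
pose C := [fset p j | j in B & s (p j) == j]%fset.
have -> : summability.partial_sum y B = summability.partial_sum (y \o s) C.
  rewrite !psE imE; apply/esym/big_fset_incl.
    apply/fsubsetP => _ /imfsetP[_ /imfsetP[j /= + ->] ->].
    by rewrite inE /= => /andP[jB /eqP ->].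
  move=> j jB jC; apply: y0; apply: contra jC => /eqP spj.
  rewrite -spj; apply/in_imfset/imfsetP; exists j => //=.
  by rewrite inE /= jB spj eqxx.
apply: AU => /=; apply/fsubsetP => i iA; apply/imfsetP; exists (s i) => /=.
  by rewrite inE /= sK eqxx andbT; apply/(fsubsetP AB)/in_imfset.
by rewrite sK.
Qed.

Section Subspace.
Variables (K : pzRingType) (V : lmodType K) (L : set V).
Hypothesis subL : is_subspace L.

Lemma subspaceD u v : L u -> L v -> L (u + v).
Proof. by move=> Lu Lv; rewrite -[u]scale1r; apply: subL.2. Qed.

Lemma subspaceZ c u : L u -> L (c *: u).
Proof. by move=> Lu; rewrite -[c *: u]addr0; apply: subL.2 => //; exact: subL.1. Qed.

Lemma subspaceB u v : L u -> L v -> L (u - v).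
Proof. by move=> Lu Lv; rewrite -scaleN1r; apply/subspaceD/subspaceZ. Qed.

Lemma subspace_sum (I : Type) (s : seq I) (x : I -> V) :
  (forall i, L (x i)) -> L (\sum_(i <- s) x i).
Proof.
by move=> Lx; elim/big_ind : _ => [||i _]; [exact: subL.1 | exact: subspaceD | exact: Lx].
Qed.

End Subspace.

Lemma closed_rnormP (R : realType) (V : normedModType R[i]) (L : set V) :
  closed L <->
  forall v, (forall e : R, 0 < e -> exists2 w, L w & rnorm (v - w) < e) -> L v.
Proof.
split=> [cL v vL|cL v vL].
  apply: cL => U /nbhs_ballP[e]; rewrite /= ltcE => /andP[/eqP /= ei e0] eU.
  have [w Lw vw] := vL _ e0; exists w; split => //; apply: eU.
  have : `|v - w| < e by rewrite (normE_rnorm (v - w)) ltcE /= ei eqxx.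
  by rewrite -ball_normE.
apply: cL => e e0; have := vL _ (nbhsx_ballx v e%:C%C _).
rewrite ltcR => /(_ e0)[w [Lw]]; rewrite -ball_normE => vw; exists w => //.
by rewrite -ltcR -(normE_rnorm (v - w)).
Qed.

Section DruryArvesonSpace.
Variables (R : realType) (n : nat).
Implicit Types (k l : mindex n).

(** * Norm estimates, density of polynomials, and tensor subspaces through coefficients *)

Section Norm.
Variable V : normedModType R[i].
Implicit Types (F G : H2 n V) (L : set V).

Lemma coef_sqnorm_fin F : (coef_sqnorm (h2_coef F) \is a fin_num)%E.
Proof.
rewrite ge0_fin_numE; first exact: (h2_coefP F).1.
by apply: esum_ge0 => k _; rewrite lee_fin; exact: coef_term_ge0.
Qed.

Lemma sqr_h2_norm F : (h2_norm F ^+ 2)%:E = coef_sqnorm (h2_coef F).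
Proof.
rewrite sqr_sqrtr ?fineK ?coef_sqnorm_fin// fine_ge0//.
by apply: esum_ge0 => k _; rewrite lee_fin; exact: coef_term_ge0.
Qed.

(** Continuity of the coefficient maps, because a single term is at most the whole sum; it makes
    coefficient conditions closed in [closed_coef_in]. *)
Lemma rnorm_coef_le F k : rnorm (h2_coef F k) <= h2_norm F * Num.sqrt (gamma R k).
Proof.
have n0 : 0 <= h2_norm F by exact: sqrtr_ge0.
rewrite -(@ler_pXn2r _ 2) ?nnegrE ?rnorm_ge0 ?mulr_ge0 ?sqrtr_ge0//.
rewrite exprMn (sqr_sqrtr (gamma_ge0 R k)) -ler_pdivrMr ?gamma_gt0//.
rewrite -lee_fin sqr_h2_norm.
have := le_esum_fset (fun l => rnorm (h2_coef F l) ^+ 2 / gamma R l) [fset k]%fset.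
by rewrite big_seq_fset1.
Qed.

Lemma h2_norm_le F (e : R) : 0 <= e ->
    (forall A : {fset mindex n},
      \sum_(k <- A) rnorm (h2_coef F k) ^+ 2 / gamma R k <= e ^+ 2) ->
  h2_norm F <= e.
Proof.
move=> e0 Fe; rewrite -(@ler_pXn2r _ 2) ?nnegrE ?sqrtr_ge0// -lee_fin sqr_h2_norm.
exact: (esum_le_bound (coef_term_ge0 _) Fe).
Qed.

Lemma h2_mono_dense F (e : R) : 0 < e -> exists A : {fset mindex n},
  h2_norm (F - \sum_(k <- A) h2_mono k (h2_coef F k)) < e.
Proof.
(* Half of [e], since [h2_norm_le] yields only a non-strict bound. *)
move=> e0; have e2 : 0 < e / 2 by rewrite divr_gt0.
have := (coef_sqnorm_bounded _).1 (h2_coefP F).1.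
move=> /(bounded_sums_tail (exprn_gt0 2 e2) (coef_term_ge0 _))[A Ae].
exists A; apply: (@le_lt_trans _ _ (e / 2)); last lra.
apply: h2_norm_le => [|B]; first exact: ltW.
apply: le_trans (ltW (Ae (B `\` A)%fset _)); last first.
  by apply/fdisjointP => k kA; rewrite inE kA.
have dE k : h2_coef (F - \sum_(k <- A) h2_mono k (h2_coef F k)) k =
    if k \in A then 0 else h2_coef F k.
  rewrite h2_coefB h2_coef_sum (@fsum_single _ _ _ _ k); last first.
    by move=> l lk; rewrite h2_coef_mono eq_sym (negbTE lk).
  by rewrite h2_coef_mono eqxx; case: ifP; rewrite ?subrr ?subr0.
rewrite le_eqVlt; apply/orP; left; apply/eqP.
rewrite -(big_fset_incl _ (fsubsetDl B A)); last first.
  by move=> k kB; rewrite !inE kB andbT negbK dE => ->; rewrite rnorm0 expr0n/= mul0r.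
rewrite big_seq [RHS]big_seq; apply: eq_bigr => k; rewrite inE => /andP[/negbTE kA _].
by rewrite dE kA.
Qed.

Lemma h2_norm_mono0 (v : V) : h2_norm (h2_mono (mindex0 n) v) <= rnorm v.
Proof.
apply: h2_norm_le => [|A]; first exact: rnorm_ge0.
rewrite (@fsum_single _ _ _ _ (mindex0 n)); last first.
  by move=> l lk; rewrite h2_coef_mono (negbTE lk) rnorm0 expr0n/= mul0r.
rewrite h2_coef_mono eqxx gamma_mindex0 divr1.
by case: ifP => // _; exact: sqr_ge0.
Qed.

Lemma h2_mono_linear k (c : R[i]) (u v : V) :
  h2_mono k (c *: u + v) = c *: h2_mono k u + h2_mono k v.
Proof.
apply: h2_coef_inj; apply/funext => l.
by rewrite h2_coefD h2_coefZ !h2_coef_mono; case: ifP; rewrite ?scaler0 ?addr0.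
Qed.

Lemma closed_coef_in L : is_subspace L -> closed L ->
  h2_closed_subspace [set F : H2 n V | forall k, L (h2_coef F k)].
Proof.
move=> subL /closed_rnormP cL; split; [split|].
- by move=> k; rewrite h2_coef0; exact: subL.1.
- by move=> c F G LF LG k; rewrite h2_coefD h2_coefZ; exact: subL.2.
move=> F FL k; apply: cL => e e0.
have g0 : 0 < Num.sqrt (gamma R k) by rewrite sqrtr_gt0 gamma_gt0.
have [G LG FG] := FL _ (divr_gt0 e0 g0); exists (h2_coef G k) => //.
by rewrite -h2_coefB (le_lt_trans (rnorm_coef_le _ _))// -ltr_pdivlMr.
Qed.

Lemma h2_coef_tens (f : H2 n R[i]^o) (v : V) k :
  h2_coef (h2_tens f v) k = h2_coef f k *: v.
Proof.
have [foo fE] := h2_coefP f.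
rewrite (@h2_coefE _ _ _ _ (fun k => h2_coef f k *: v))//; split; last first.
  move=> z; have := has_sumZl (v := v) (fE z); apply: has_sum_eq => l.
  by rewrite scalerA.
apply/coef_sqnorm_bounded.
apply: le_bounded_sums (bounded_sumsZ (sqr_ge0 (rnorm v))
  ((coef_sqnorm_bounded _).1 foo)) => l.
by rewrite rnormZ exprMn mulrA [_ * rnorm v ^+ 2]mulrC.
Qed.

(** The coefficient condition is one of the subspaces being intersected. Conversely, any of those
    subspaces contains the monomials with coefficients in [L], hence the limits of their sums. *)
Lemma h2_tensorE L : is_subspace L -> closed L ->
  h2_tensor L = [set F : H2 n V | forall k, L (h2_coef F k)].
Proof.
move=> subL cL; apply/seteqP; split => [F|F LF N [clN NL]].
  apply; split; first exact: closed_coef_in.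
  by move=> f v Lv k; rewrite h2_coef_tens; exact: subspaceZ.
apply: clN.2 => e /(h2_mono_dense F)[A FA].
exists (\sum_(k <- A) h2_mono k (h2_coef F k)) => //.
apply: (subspace_sum clN.1) => k.
have -> : h2_mono k (h2_coef F k) =
    h2_tens (h2_mono k (1 : R[i]^o)) (h2_coef F k).
  apply: h2_coef_inj; apply/funext => l; rewrite h2_coef_tens !h2_coef_mono.
  by case: ifP; rewrite ?scale1r ?scale0r.
exact: NL.
Qed.

End Norm.

(** * Backward shifts, adjoints and reducing subspaces *)

Section Adjoint.
Variables (E : completeNormedModType R[i]) (dot : {dot E for Num.conj}).
Implicit Types F G : H2 n E.

(** Completeness of [E] enters here: the series converges absolutely at each point of the ball, so
    it defines a function. *)
Lemma h2_coef_surj (a : mindex n -> E) :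
  (coef_sqnorm a < +oo)%E -> exists F : H2 n E, h2_coef F = a.
Proof.
move=> aoo; have /choice[f fa] (z : unit_ball R n) :
    exists v : E, has_sum (fun k => monomial z k *: a k) v.
  by apply: bounded_sums_has_sum; exact: expansion_bounded.
have fP : f \in @h2_pred R n E by apply/asboolP; exists a.
by exists (MkH2 fP); apply: h2_coefE.
Qed.

(** The weight of the backward shift, equal to (k_i + 1) / (|k| + 1) by [gamma_ratio]. *)
Definition shift_ratio i k : R := gamma R k / gamma R (mincr i k).

Lemma shift_ratio_gt0 i k : 0 < shift_ratio i k.
Proof. by rewrite divr_gt0// gamma_gt0. Qed.

Lemma shift_ratioC i k :
  (shift_ratio i k)%:C%C = (gamma R k)%:C%C / (gamma R (mincr i k))%:C%C.
Proof. exact: (fmorph_div (real_complex R)). Qed.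

Lemma backward_shift_exists i : exists S : H2 n E -> H2 n E, forall G k,
  h2_coef (S G) k = (shift_ratio i k)%:C%C *: h2_coef G (mincr i k).
Proof.
suff /choice[S SP] (G : H2 n E) : exists F : H2 n E, h2_coef F =
    fun k => (shift_ratio i k)%:C%C *: h2_coef G (mincr i k).
  by exists S => G k; rewrite SP.
apply: h2_coef_surj; apply/coef_sqnorm_bounded.
have [B GB] := (coef_sqnorm_bounded _).1 (h2_coefP G).1; exists B => A.
apply: le_trans (GB (mincr i @` A)%fset).
rewrite big_imfset/=; last by move=> ? ? _ _; exact: can_inj (@mincrK n i) _ _.
apply: ler_sum => k _; rewrite rnormZ (cabsR (ltW (shift_ratio_gt0 i k))).
have r1 : shift_ratio i k <= 1.
  by rewrite ler_pdivrMr ?gamma_gt0// mul1r gamma_mincr.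
(* One factor of the squared ratio turns [gamma R k] into [gamma R (mincr i k)]; the other is at
   most 1. *)
have -> : (shift_ratio i k * rnorm (h2_coef G (mincr i k))) ^+ 2 / gamma R k =
    shift_ratio i k * (rnorm (h2_coef G (mincr i k)) ^+ 2 / gamma R (mincr i k)).
  by rewrite /shift_ratio; field; rewrite !gamma_neq0.
by apply: ler_piMl => //; rewrite divr_ge0 ?sqr_ge0 ?gamma_ge0.
Qed.

Lemma dotZr (v w : E) (x : R) : dot v (x%:C%C *: w) = x%:C%C * dot v w.
Proof. by rewrite linearZr_LR /= conj_Creal// complex_real. Qed.

Lemma dotBr (u v w : E) : dot u (v - w) = dot u v - dot u w.
Proof. exact: linearBr. Qed.

(** The terms pairing [Mz i F] with [G] vanish off the range of [mincr i]; reindexed along it, they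
    equal those pairing [F] with [S G] one by one. *)
Lemma backward_shift_adjoint i S :
  (forall G k, h2_coef (S G) k = (shift_ratio i k)%:C%C *: h2_coef G (mincr i k)) ->
  h2_adjoint dot (@Mz R n E i) S.
Proof.
move=> SE F G; rewrite /h2_dot (sum_inj (@mincrK n i)).
  apply: (congr1 (fun x : mindex n -> R[i]^o => summability.sum x)); apply/funext => k.
  rewrite h2_coef_Mz ffunE eqxx addn1 mincrK SE dotZr shift_ratioC.
  by field; rewrite !(fmorph_eq0 (real_complex R)) !gamma_neq0.
move=> k; rewrite h2_coef_Mz; case: ifPn => [/mincr_mdecr ->|_ _]; first by rewrite eqxx.
by rewrite linear0l mul0r.
Qed.

Lemma h2_dot_mono k v G :
  h2_dot dot (h2_mono k v) G = dot v (h2_coef G k) / (gamma R k)%:C%C.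
Proof.
pose x l : R[i]^o := dot (h2_coef (h2_mono k v) l) (h2_coef G l) / (gamma R l)%:C%C.
have : has_sum x (\sum_(l <- [fset k]%fset) x l).
  apply: has_sum_fin => l; rewrite inE /x h2_coef_mono => /negbTE ->.
  by rewrite linear0l mul0r.
rewrite big_seq_fset1 {2}/x h2_coef_mono eqxx => xk.
exact: (cvg_lim (@norm_hausdorff _ R[i]^o) xk).
Qed.

Lemma adjoint_coef i S G k : h2_adjoint dot (@Mz R n E i) S ->
  h2_coef (S G) k = (shift_ratio i k)%:C%C *: h2_coef G (mincr i k).
Proof.
move=> adjS; set w := (X in _ = X).
have dotw v : dot v (h2_coef (S G) k - w) = 0.
  have := adjS (h2_mono k v) G; rewrite Mz_mono !h2_dot_mono => eqv.
  rewrite dotBr /w dotZr shift_ratioC -mulrA [_^-1 * _]mulrC eqv.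
  by rewrite mulrCA divff ?mulr1 ?subrr// fmorph_eq0 gamma_neq0.
(* The difference is orthogonal to every vector, in particular to itself, so definiteness of [dot]
   makes it zero. *)
apply/eqP; rewrite -subr_eq0; apply/negPn/negP => w0.
by have := @neq0_dnorm_gt0 _ _ _ dot _ w0; rewrite dotw ltxx.
Qed.

Lemma reducing_tensor L : is_subspace L -> closed L ->
  h2_reducing dot (@Mz R n E) (h2_tensor L).
Proof.
move=> subL cL i; rewrite h2_tensorE//; split => [F LF k|].
  by rewrite h2_coef_Mz; case: ifP => // _; exact: subL.1.
have [S SE] := backward_shift_exists i; exists S.
  exact: backward_shift_adjoint.
by move=> F LF k; rewrite SE; exact: subspaceZ.
Qed.

(* [I - sum_i M_i M_i^*] is the projection onto the constant functions. *)
Lemma h2_defect (S : 'I_n -> H2 n E -> H2 n E) F :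
    (forall i G k, h2_coef (S i G) k =
       (shift_ratio i k)%:C%C *: h2_coef G (mincr i k)) ->
  F - \sum_i Mz i (S i F) = h2_mono (mindex0 n) (h2_coef F (mindex0 n)).
Proof.
move=> SE; apply: h2_coef_inj; apply/funext => k.
rewrite h2_coefB h2_coef_sum h2_coef_mono; have [->|k0] := eqVneq k (mindex0 n).
  rewrite big1 ?subr0// => i _; by rewrite h2_coef_Mz ffunE.
apply/eqP; rewrite subr_eq0 eq_sym; apply/eqP.
pose r i : R := gamma R (mdecr i k) / gamma R k.
(* Away from index 0, each [Mz i (S i F)] carries the share [r i] of the coefficient of [F], and
   these shares add up to 1 by [sum_gamma_mdecr]. *)
transitivity (\sum_(i | (0 < k i)%N) (r i)%:C%C *: h2_coef F k).
  rewrite [RHS]big_mkcond; apply: eq_bigr => i _; rewrite h2_coef_Mz.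
  by case: ifP => // ki; rewrite SE mincr_mdecr// /shift_ratio mincr_mdecr.
rewrite -scaler_suml -rmorph_sum -mulr_suml sum_gamma_mdecr// divff ?scale1r//.
exact: gamma_neq0.
Qed.

Lemma reducing_is_tensor (M : set (H2 n E)) : h2_closed_subspace M ->
    h2_reducing dot (@Mz R n E) M ->
  exists L : set E, [/\ is_subspace L, closed L & M = h2_tensor L].
Proof.
move=> [subM cM] redM; pose c0 (v : E) := h2_mono (mindex0 n) v.
pose L : set E := [set v | M (c0 v)].
have subL : is_subspace L.
  split=> [|c u v Lu Lv]; last by rewrite /L/= /c0 h2_mono_linear; exact: subM.2.
  rewrite /L/= (_ : c0 0 = 0); first exact: subM.1.
  by apply: h2_coef_inj; apply/funext => k; rewrite h2_coef0 h2_coef_mono if_same.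
have cL : closed L.
  (* Closedness passes from [M] to [L] because [c0] is linear and does not increase norms. *)
  apply/closed_rnormP => v vL; apply: cM => e /vL[w Lw vw]; exists (c0 w) => //.
  rewrite /c0 -scaleN1r addrC -h2_mono_linear scaleN1r addrC.
  exact: le_lt_trans (h2_norm_mono0 _) vw.
have /choice[S SP] i : exists S : H2 n E -> H2 n E,
    h2_adjoint dot (@Mz R n E i) S /\ forall F, M F -> M (S F).
  by have [_ [S adjS MS]] := redM i; exists S.
have SE i G k := adjoint_coef G k (SP i).1.
exists L; split => //; rewrite h2_tensorE//; apply/seteqP; split => [F MF k|F LF].
  elim/mindex_ind: k F MF => [F MF|i k IHk F MF].
    rewrite /L/= /c0 -(h2_defect F SE); apply: subspaceB => //.
    by apply: subspace_sum => // i; apply: (redM i).1; exact: (SP i).2.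
  (* The coefficient of [F] at [mincr i k] is a scalar multiple of the coefficient at [k] of
     [S i F], which is again in [M]. *)
  have := subspaceZ subL (shift_ratio i k)^-1%:C%C (IHk _ ((SP i).2 _ MF)).
  rewrite SE scalerA -rmorphM mulVf ?scale1r//.
  exact/lt0r_neq0/shift_ratio_gt0.
(* Conversely, [M] contains the constants from [L] and is invariant under the shifts, so it contains
   the monomials with coefficients in [L]; density and closedness finish. *)
apply: cM => e /(h2_mono_dense F)[A FA].
exists (\sum_(k <- A) h2_mono k (h2_coef F k)) => //.
apply: subspace_sum => // k; move: (h2_coef F k) (LF k) => v Lv.
elim/mindex_ind: k => // i k IHk; rewrite -Mz_mono.
exact: (redM i).1.
Qed.

End Adjoint.
End DruryArvesonSpace.

Theorem lemma4p2 (R : realType) (n : nat) (E : completeNormedModType R[i])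
    (dot : {dot E for Num.conj}) (dotE : forall v : E, `|v| ^+ 2 = dot v v)
    (M : set (H2 n E)) (closedM : h2_closed_subspace M) :
  h2_reducing dot (@Mz R n E) M <->
  exists L : set E, [/\ is_subspace L, closed L & M = h2_tensor L].
Proof.
split=> [|[L [subL cL ->]]]; first exact: reducing_is_tensor.
exact: reducing_tensor.
Qed.
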